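(* (ZFC) For every infinite regular cardinal $\kappa$ and every sequence $\bar p=\langle p_\delta:\delta<\kappa^+\rangle$ of partitions $p_\delta:[\kappa^+]^2\to n_\delta$ with $n_\delta<\omega$, $\kappa^+\nrightarrow_{\bar p}[\kappa^+\circledast\kappa^+]^2_{\kappa^+}$ holds. In particular, for every finite partition $p:[\omega_1]^2\to n$, both $\omega_1\nrightarrow_p[\omega_1\circledast\omega_1]^2_{\omega_1}$ and $\omega_1\nrightarrow_p[\omega_1]^2_{\omega_1}$ hold.
   Context: For $f:[\kappa]^2\to\lambda$ and $p:[\kappa]^2\to\theta$, $X\subseteq[\kappa]^2$ is $(f,p)$-strong if for every $\zeta:\theta\to\lambda$ there is $\{\alpha,\beta\}\in X$ with $f(\alpha,\beta)=\zeta(p(\alpha,\beta))$. $A\circledast B=\{\{\alpha,\beta\}:\alpha<\beta,\ \alpha\in A,\ \beta\in B\}$. $\kappa\nrightarrow_p[\mu]^2_\lambda$: there is $f:[\kappa]^2\to\lambda$ with $[A]^2$ $(f,p)$-strong for every $A\in[\kappa]^\mu$. $\kappa\nrightarrow_p[\mu_1\circledast\mu_2]^2_\lambda$: there is $f$ with $A\circledast B$ $(f,p)$-strong for all $A\in[\kappa]^{\mu_1}$, $B\in[\kappa]^{\mu_2}$. With a sequence $\bar p=\langle p_\delta\rangle$ in place of $p$: a single $f$ witnesses the symbol for each $p_\delta$. *)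

(* Defs.v *)
(* cardinals are modelled by
   well-ordered types. *)
From Stdlib Require Import Relations Wellfounded.
From mathcomp Require Import all_boot.
Set Implicit Arguments. Unset Strict Implicit. Unset Printing Implicit Defensive.

Definition card_le (A B : Type) : Prop := exists f : A -> B, injective f.

Definition well_order (T : Type) (lt : T -> T -> Prop) : Prop :=
  well_founded lt /\ (forall x y z, lt x y -> lt y z -> lt x z) /\
  (forall x, ~ lt x x) /\ (forall x y, lt x y \/ x = y \/ lt y x).

Definition seg (T : Type) (lt : T -> T -> Prop) (x : T) : Type := {y : T | lt y x}.

(* (T, lt) is an initial ordinal, i.e. (the von Neumann representative of) a cardinal *)
Definition initial_ordinal (T : Type) (lt : T -> T -> Prop) : Prop :=
  well_order lt /\ forall x : T, ~ card_le T (seg lt x).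

Definition infinite_regular_cardinal (K : Type) (lt : K -> K -> Prop) : Prop :=
  initial_ordinal lt /\ card_le nat K /\
  forall S : K -> Prop, ~ card_le K {x : K | S x} ->
    exists b : K, forall s, S s -> lt s b.

Definition successor_cardinal (K : Type) (L : Type) (ltL : L -> L -> Prop) : Prop :=
  initial_ordinal ltL /\ card_le K L /\ ~ card_le L K /\
  forall x : L, card_le (seg ltL x) K.

Definition has_size_of (L : Type) (A : L -> Prop) : Prop := card_le L {x : L | A x}.

(* Colourings of [L]^2 are given as functions of (alpha, beta), used only for
   alpha < beta.  X = A circledast B = {{a,b} : a < b, a in A, b in B}.
   A circledast B is (f,p)-strong: for every zeta : theta -> lambda some pair in it
   has f = zeta o p. *)
Definition strong_circ (L : Type) (ltL : L -> L -> Prop) (Lam : Type) (n : nat)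
  (f : L -> L -> Lam) (p : L -> L -> 'I_n) (A B : L -> Prop) : Prop :=
  forall zeta : 'I_n -> Lam,
    exists a b : L, [/\ ltL a b, A a, B b & f a b = zeta (p a b)].

Definition strong_sq (L : Type) (ltL : L -> L -> Prop) (Lam : Type) (n : nat)
  (f : L -> L -> Lam) (p : L -> L -> 'I_n) (A : L -> Prop) : Prop :=
  strong_circ ltL f p A A.

(* Main.v *)
From HB Require Import structures.
From Stdlib Require Import Relations Wellfounded.
From mathcomp Require Import all_boot all_order.
From mathcomp Require Import boolp zify.
Require Import Defs.

Set Implicit Arguments. Unset Strict Implicit. Unset Printing Implicit Defensive.
Import Order.TTheory.
Local Open Scope order_scope.

(* A colour can code a pair (delta, zeta), and the pair (a, b) can then be
   recoloured by zeta (p_delta a b); so it is enough to find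
   F : [kappa^+]^2 -> kappa^+ taking every colour on every rectangle A * B with
   A and B unbounded.  F comes from Todorcevic's walks and Moore's oscillations
   of the functions [height ^~ a] and [height ^~ b] along the lower trace of the
   walk from b to a: F a b = phi x, where x is the point of that walk whose index
   is the 2-adic valuation of the oscillation number, and phi is a map all of
   whose fibres contain stationarily many points of cofinality kappa.
   If x has colour phi x = c and is reached from b after k steps, then the walks
   from b to all a < x close to x go through x at step k.  Moore's argument gives
   one a in A and arbitrarily many such (x_m, b_m), with the same k, whose
   oscillation numbers with a are consecutive; for one of them the valuation is k.
   Letting b depend on x is what yields kappa^+ colours instead of omega. *)

(** * Well-founded recursion and cardinality *)

(** The relation [lt], made boolean by [asbool], is packed as an order type on [{classic T}].
    Extensionality identifies it with the strict order of that type, so [G] transfers. *)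
Lemma well_order_elim (G : forall T : Type, (T -> T -> Prop) -> Prop) :
  (forall (d : Order.disp_t) (T : orderType d), G T (fun x y : T => x < y)) ->
  forall (T : Type) (lt : T -> T -> Prop), well_order lt -> G T lt.
Proof.
move=> GO T lt [_ [tr [irr tot]]].
pose ltb (x y : {classic T}) := `[< lt x y >].
have ltb_irr : irreflexive ltb by move=> x; apply/asboolP/irr.
have ltb_trans : transitive ltb.
  by move=> y x z /asboolP xy /asboolP yz; apply/asboolP/(tr _ y).
pose PB := Order.Lt_isPOrder.Build (Order.Disp tt tt) {classic T} ltb_irr ltb_trans.
pose PT : porderType (Order.Disp tt tt) := HB.pack {classic T} PB.
have tot_le : total (<=%O : rel PT).
  move=> x y; have [xy|[->|yx]] := tot x y; rewrite !le_eqVlt ?eqxx //.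
    by apply/orP; left; apply/orP; right; apply/asboolP.
  by apply/orP; right; apply/orP; right; apply/asboolP.
pose TB := Order.POrder_isTotal.Build (Order.Disp tt tt) PT tot_le.
pose OT : orderType (Order.Disp tt tt) := HB.pack PT TB.
have -> : lt = (fun x y : OT => x < y).
  by apply/funext => x; apply/funext => y; apply/propext; split=> /asboolP.
exact: (GO _ OT).
Qed.

Lemma wf_ex_least d (T : orderType d) (P : T -> Prop) :
  well_founded (fun x y : T => x < y) -> (exists x, P x) ->
  exists x, P x /\ forall y, P y -> x <= y.
Proof.
move=> wf [x0 Px0]; apply: contrapT => nleast.
elim: (wf x0) Px0 => x _ IH Px; apply: nleast; exists x; split=> // y Py.
by rewrite leNgt; apply/negP => yx; apply: (IH y).
Qed.

(** Each value is chosen in relation to all earlier ones. With [Q] a disequality this builds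
    injections, with [Q] a strict order it builds increasing sequences. *)
Lemma wf_rec_rel (D V : Type) (R : D -> D -> Prop) (Q : V -> V -> Prop) :
  well_founded R ->
  (forall q (g : {p | R p q} -> V), exists v, forall p, Q (g p) v) ->
  exists F : D -> V, forall p q, R p q -> Q (F p) (F q).
Proof.
move=> wf H.
pose step q (rec : forall p, R p q -> V) :=
  sval (cid (H q (fun p => rec (sval p) (svalP p)))).
exists (Fix wf (fun=> V) step) => p q Rpq.
rewrite [X in Q _ X]Fix_eq; last first.
  move=> x f g fg; congr (step x _).
  by apply: functional_extensionality_dep => y; apply/funext => Ry.
rewrite /step; case: cid => v /= Hv; exact: (Hv (exist _ p Rpq)).
Qed.

Lemma sval_inj (T : Type) (P : T -> Prop) : injective (fun x : {x | P x} => sval x).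
Proof. by move=> [x Px] [y Py] /= exy; apply: eq_exist. Qed.

Lemma card_le_trans (A B C : Type) : card_le A B -> card_le B C -> card_le A C.
Proof. by move=> [f fi] [g gi]; exists (g \o f); apply: inj_comp. Qed.

Lemma card_le_sig (A T : Type) (P : A -> Prop) (Q : T -> Prop) (f : A -> T) :
  (forall x, P x -> Q (f x)) ->
  (forall x y, P x -> P y -> f x = f y -> x = y) ->
  card_le {x | P x} {x | Q x}.
Proof.
move=> PQ fi; exists (fun x => exist Q (f (sval x)) (PQ _ (svalP x))).
by move=> [x Px] [y Py] [] /= /fi -/(_ Px Py) exy; apply: sval_inj.
Qed.

Lemma card_le_sigl (A T : Type) (P : A -> Prop) (f : A -> T) :
  (forall x y, P x -> P y -> f x = f y -> x = y) -> card_le {x | P x} T.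
Proof.
move=> fi; exists (fun x => f (sval x)).
by move=> [x Px] [y Py] /= /fi -/(_ Px Py) exy; apply: sval_inj.
Qed.

Lemma card_le_sub (T : Type) (P Q : T -> Prop) :
  (forall x, P x -> Q x) -> card_le {x | P x} {x | Q x}.
Proof. by move=> PQ; apply: (card_le_sig (f := id)). Qed.

(** * Small sets and coding for a regular cardinal *)

Section RegularCardinal.
Context (d : Order.disp_t) (K : orderType d).
Hypothesis regK : infinite_regular_cardinal (fun x y : K => x < y).

Lemma regular_wf : well_founded (fun x y : K => x < y).
Proof. by case: regK => [[[wf _] _] _]. Qed.

Lemma card_seg_small (m : K) : ~ card_le K {x : K | x < m}.
Proof. by case: regK => [[_ small] _]; apply: small. Qed.

Lemma regular_inhabited : exists x : K, True.
Proof. by case: regK => _ [[f _] _]; exists (f 0%N). Qed.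

Lemma card_small_subsingleton (D : Type) : (forall x y : D, x = y) -> ~ card_le K D.
Proof.
move=> D1 [g gi]; case: regK => _ [[f fi] _].
by have /gi/fi := D1 (g (f 0%N)) (g (f 1%N)).
Qed.

Lemma regular_no_max (x : K) : exists y, x < y.
Proof.
case: (regK) => _ [_ reg]; case: (reg (fun y => y = x)).
  apply: card_small_subsingleton => a b; apply: sval_inj.
  by rewrite (svalP a) (svalP b).
by move=> b Hb; exists b; apply: Hb.
Qed.

(** Regularity as a statement about unions. If [F] embeds [K] in [D], the indices that [F] sends
    into the fibre of [j] have a bound [b j], and the [b j] with [j < m] have a bound [c]; the fibre
    of [F c] gives a contradiction. *)
Lemma card_small_fibers (D : Type) (i : D -> K) (m : K) :
  (forall x, i x < m) -> (forall j, ~ card_le K {x | i x = j}) -> ~ card_le K D.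
Proof.
move=> im small [F Fi]; case: (regK) => _ [_ reg].
have /choice [b Hb] : forall j, exists b, forall k, i (F k) = j -> k < b.
  move=> j; apply: reg => le; apply: (small j); apply: (card_le_trans le).
  by apply: (card_le_sig (f := F)) => // x y _ _ /Fi.
have [c Hc] : exists c, forall s, (exists2 j, j < m & s = b j) -> s < c.
  apply: reg => le; apply: (@card_seg_small m); apply: (card_le_trans le).
  have /choice [h Hh] : forall s, exists j, (exists2 j, j < m & s = b j) ->
      j < m /\ s = b j.
    move=> s; have [[j jm e]|n] := EM (exists2 j, j < m & s = b j); first by exists j.
    by exists m.
  apply: (card_le_sig (f := h)) => [x /Hh[] //|x y /Hh[_ {2}->] /Hh[_ {2}->] -> //].
have := Hb (i (F c)) c erefl; rewrite ltNge => /negP; apply.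
by apply: ltW; apply: Hc; exists (i (F c)).
Qed.

(** Pairs are well-ordered by their maximum, then lexicographically. An initial segment lies in the
    square of a proper segment of [K], which is small by regularity, so a value avoiding all earlier
    ones exists. *)
Lemma card_prod : card_le (K * K) K.
Proof.
pose ltK := fun x y : K => x < y.
pose key (p : K * K) := (Order.max p.1 p.2, p).
pose R p q := slexprod _ _ ltK (slexprod _ _ ltK ltK) (key p) (key q).
have wfR : well_founded R.
  by apply: wf_inverse_image; do ?apply: wf_slexprod; exact: regular_wf.
have Rmax p q : R p q -> Order.max p.1 p.2 <= Order.max q.1 q.2.
  by rewrite /R /key => H; inversion H => //; apply: ltW.
have [F HF] : exists F : K * K -> K, forall p q, R p q -> F p <> F q.
  apply: (wf_rec_rel (Q := fun a b => a <> b)) => // q g; apply: contrapT => nv.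
  have /choice [f Hf] : forall v, exists p, g p = v.
    move=> v; apply: contrapT => np; apply: nv; exists v => p gp.
    by apply: np; exists p.
  have : card_le K {p | R p q}.
    by exists f => x y exy; rewrite -(Hf x) exy Hf.
  have [m Hm] := regular_no_max (Order.max q.1 q.2).
  have lt_m (p : {p | R p q}) : (sval p).1 < m /\ (sval p).2 < m.
    have := le_lt_trans (Rmax _ _ (svalP p)) Hm.
    by rewrite gt_max => /andP.
  apply: (@card_small_fibers _ (fun p => (sval p).1) m) => [p|j].
    by case: (lt_m p).
  move=> le; apply: (@card_seg_small m); apply: (card_le_trans le).
  apply: (card_le_sig (f := fun p => (sval p).2)) => [p _|x y ex ey exy].
    by case: (lt_m p).
  apply: sval_inj; rewrite [LHS]surjective_pairing [RHS]surjective_pairing.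
  by rewrite ex ey exy.
exists F => p q Fpq; apply: contrapT => npq.
suff [/HF|/HF] : R p q \/ R q p by move=> nF; apply: nF.
rewrite /R /key; case: (ltgtP (Order.max p.1 p.2) (Order.max q.1 q.2)) => [h|h|].
  by left; apply: left_slex.
  by right; apply: left_slex.
move=> ->; case: p q npq {Fpq} => [a b] [a' b'] npq.
have [aa'|aa'|aa'] := ltgtP a a'; first by left; apply: right_slex; apply: left_slex.
  by right; apply: right_slex; apply: left_slex.
subst a'; have [bb'|bb'|bb'] := ltgtP b b'.
  by left; apply: right_slex; apply: right_slex.
  by right; apply: right_slex; apply: right_slex.
by case: npq; rewrite bb'.
Qed.

Lemma card_seq : card_le (seq K) K.
Proof.
have [pair pair_inj] := card_prod; have [z _] := regular_inhabited.
case: (regK) => _ [[nk nk_inj] _].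
pose code := foldr (fun x c => pair (x, c)) z.
exists (fun s => pair (nk (size s), code s)) => s t /pair_inj [] /nk_inj.
elim: s t => [|x s IH] [|y t] //= [est] /pair_inj [-> e].
by rewrite (IH t).
Qed.

Lemma card_small_union (D : Type) (i : D -> K) (m : K) (P : D -> Prop) :
  (forall x, P x -> i x < m) -> (forall j, ~ card_le K {x | P x /\ i x = j}) ->
  ~ card_le K {x | P x}.
Proof.
move=> im small.
apply: (@card_small_fibers _ (fun x => i (sval x)) m) => [[x Px]|j le].
  exact: im.
apply: (small j); apply: (card_le_trans le).
apply: (card_le_sig (f := fun x => sval x)) => [[x Px]|x y _ _ /sval_inj] //.
Qed.

Lemma card_small_or (D : Type) (P Q : D -> Prop) :
  ~ card_le K {x | P x} -> ~ card_le K {x | Q x} -> ~ card_le K {x | P x \/ Q x}.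
Proof.
move=> sP sQ; have [z _] := regular_inhabited.
have [y zy] := regular_no_max z; have [m ym] := regular_no_max y.
apply: (@card_small_union _ (fun x => if `[< P x >] then z else y) m) => [x _|j le].
  by case: ifP => // _; apply: lt_trans ym.
have [ej|nj] := eqVneq j z.
  apply: sP; apply: (card_le_trans le); apply: card_le_sub => x [_].
  by case: asboolP => // _ eyj; rewrite -eyj in ej; rewrite ej ltxx in zy.
apply: sQ; apply: (card_le_trans le); apply: card_le_sub => x [PQ].
by case: asboolP => [_ /esym/eqP|]; [rewrite (negPf nj)|case: PQ].
Qed.

Lemma card_le_option (X : Type) : card_le X K -> card_le (option X) K.
Proof.
move=> [f fi]; have [pair pair_inj] := card_prod.
have [z _] := regular_inhabited; have [y zy] := regular_no_max z.
exists (fun o => if o is Some x then pair (z, f x) else pair (y, z)).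
move=> [a|] [b|] // /pair_inj []; first by move/fi->.
  by move=> ezy; rewrite ezy ltxx in zy.
by move=> ezy; rewrite ezy ltxx in zy.
Qed.

End RegularCardinal.

(** * Stationary subsets of a successor cardinal *)

Definition unbounded d (L : orderType d) (A : L -> Prop) : Prop :=
  forall b, exists2 a, A a & b < a.

Definition closed_under d (L : orderType d) (h : L -> L) (x : L) : Prop :=
  forall y, y < x -> h y < x.

(* The sets [closed_under h] generate the club filter. *)
Definition stationary d (L : orderType d) (Z : L -> Prop) : Prop :=
  forall h, exists2 x, Z x & closed_under h x.

Section SuccessorCardinal.
Context (d d' : Order.disp_t) (K : orderType d) (L : orderType d').
Hypothesis regK : infinite_regular_cardinal (fun x y : K => x < y).
Hypothesis succL : successor_cardinal K (fun x y : L => x < y).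

Lemma successor_wf : well_founded (fun x y : L => x < y).
Proof. by case: succL => [[[wf _] _] _]. Qed.

Lemma card_lt_seg (x : L) : card_le {y : L | y < x} K.
Proof. by case: succL => [_ [_ [_ seg]]]; apply: seg. Qed.

Lemma ex_inj_seg (x : L) : exists g : L -> K,
  forall y z, y < x -> z < x -> g y = g z -> y = z.
Proof.
have [z0 _] := regular_inhabited regK; have [f fi] := card_lt_seg x.
pose g y := if pselect (y < x) is left yx then f (exist _ y yx) else z0.
exists g => y z; rewrite /g; case: pselect => // yx; case: pselect => // zx.
by move=> _ _ /fi [].
Qed.

Lemma ex_inj_le_seg (x : L) : exists g : L -> K,
  forall y z, y <= x -> z <= x -> g y = g z -> y = z.
Proof.
have [f fi] := card_le_option regK (card_lt_seg x).
pose g y := f (if pselect (y < x) is left yx then Some (exist _ y yx) else None).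
exists g => y z; rewrite /g; case: pselect => yx; case: pselect => zx yx' zx' /fi //.
  by move=> [].
have -> : y = x by apply/le_anti; rewrite yx' leNgt; apply/negP.
by move=> _; apply/le_anti; rewrite zx' leNgt andbT; apply/negP.
Qed.

(** Otherwise [L] is covered by at most [K] many initial segments, each embeddable in [K], and so
    embeds in [K * K], hence in [K]. *)
Lemma family_bound (D : Type) (x : D -> L) : card_le D K -> exists b, forall i, x i < b.
Proof.
move=> [c ci]; apply: contrapT => nb.
have /choice [i Hi] : forall b, exists i, b <= x i.
  move=> b; apply: contrapT => ni; apply: nb; exists b => i.
  by rewrite ltNge; apply/negP => bx; apply: ni; exists i.
have /choice [g Hg] := ex_inj_le_seg.
case: succL => _ [_ [nLK _]]; apply: nLK.
apply: card_le_trans (card_prod regK).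
exists (fun y => (c (i y), g (x (i y)) y)) => y z [] /ci eyz.
by have := Hi z; rewrite -eyz => zx; apply: Hg.
Qed.

Lemma card_le_unit : card_le unit K.
Proof. by have [z _] := regular_inhabited regK; exists (fun=> z) => -[] []. Qed.

Lemma successor_no_max (x : L) : exists y, x < y.
Proof. by have [b Hb] := family_bound (fun=> x) card_le_unit; exists b; apply: (Hb tt). Qed.

Lemma size_unbounded (A : L -> Prop) : has_size_of A -> unbounded A.
Proof.
move=> sA b; apply: contrapT => na; have [c bc] := successor_no_max b.
case: succL => [[_ ini] _]; apply: (ini c); apply: (card_le_trans sA).
apply: card_le_sub => y Ay; apply: le_lt_trans bc.
by rewrite leNgt; apply/negP => by_; apply: na; exists y.
Qed.

Lemma ex_increasing (I : Type) (R : I -> I -> Prop) (h : L -> L) :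
  well_founded R -> (forall i, card_le {j | R j i} K) ->
  exists x : I -> L, forall i j, R i j -> h (x i) < x j.
Proof.
move=> wf seg; apply: (wf_rec_rel (Q := fun a b => h a < b)) => // i g.
exact: family_bound.
Qed.

Lemma unbounded_size (P : L -> Prop) : unbounded P -> has_size_of P.
Proof.
move=> uP; have /choice [p Hp] : forall b, exists a, P a /\ b < a.
  by move=> b; have [a Pa ba] := uP b; exists a.
have pP b : P (p b) by case: (Hp b).
have bp b : b < p b by case: (Hp b).
have [x Hx] := ex_increasing p successor_wf card_lt_seg.
have mono i j : i < j -> p (x i) < p (x j).
  by move=> /Hx xij; apply: lt_trans (bp _).
exists (fun i => exist P (p (x i)) (pP _)) => i j [] eij.
by case: (ltgtP i j) => // /mono; rewrite eij ltxx.
Qed.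

Lemma successor_regular : infinite_regular_cardinal (fun x y : L => x < y).
Proof.
case: succL => ini [KL _]; case: (regK) => _ [nK _]; split=> //; split.
  exact: card_le_trans KL.
move=> S; apply: contra_notP => nb; apply: unbounded_size => b.
have [c bc] := successor_no_max b.
apply: contrapT => na; apply: nb; exists c => s Ss; apply: le_lt_trans bc.
by rewrite leNgt; apply/negP => bs; apply: na; exists s.
Qed.

Lemma successor_least : exists z : L, forall x, z <= x.
Proof.
have [z _] := regular_inhabited successor_regular.
have [m [_ Hm]] := wf_ex_least (P := fun=> True) successor_wf (ex_intro _ z I).
by exists m => x; apply: Hm.
Qed.

(* These are the points of cofinality [K]. *)
Definition full_cofinality (x : L) : Prop :=
  forall X : L -> Prop, (forall y, X y -> y < x) -> ~ card_le K {y | X y} ->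
    exists2 b, b < x & forall y, X y -> y < b.

Lemma full_cofinality_gt0 x : full_cofinality x -> exists y, y < x.
Proof.
move=> /(_ (fun=> False)); case=> //; last by move=> b bx _; exists b.
by case=> f _; have [z _] := regular_inhabited regK; case: (f z).
Qed.

(** The function [h'] dominates [h] on initial segments. Iterating it [K] times gives an increasing
    sequence whose supremum [e] is closed under [h], and regularity of [K] gives [e] full
    cofinality. *)
Lemma stationary_full_cofinality : stationary full_cofinality.
Proof.
move=> h.
have /choice [h' Hh'] : forall y, exists b, forall z, z <= y -> h z < b /\ z < b.
  move=> y; have le : card_le {z | z <= y} K.
    have [g gi] := ex_inj_le_seg y; exact: card_le_sigl gi.
  have [b Hb] := family_bound (fun z => Order.max (h (sval z)) (sval z)) le.
  by exists b => z zy; apply/andP; rewrite -gt_max; apply: (Hb (exist _ z zy)).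
have seg (i : K) : card_le {j : K | j < i} K by apply: (card_le_sigl (f := id)).
have [x Hx] := ex_increasing h' (regular_wf regK) seg.
have xlt i j : i < j -> x i < x j.
  by move=> /Hx; apply: lt_trans; apply: (Hh' _ _ _).2.
have cK : card_le K K by exists id.
have [b Hb] := family_bound x cK.
have [e [Pe le_e]] :=
  wf_ex_least (P := fun e => forall i, x i < e) successor_wf (ex_intro _ b Hb).
have below y : y < e -> exists i, y <= x i.
  move=> ye; apply: contrapT => ni.
  have : e <= y.
    by apply: le_e => i; rewrite ltNge; apply/negP => yx; apply: ni; exists i.
  by rewrite leNgt ye.
exists e; last first.
  move=> y /below [i yx]; have [j ij] := regular_no_max regK i.
  apply: lt_trans (Pe j); apply: lt_trans (Hx _ _ ij); exact: (Hh' _ _ _).1.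
move=> X Xe sX; have [k0 _] := regular_inhabited regK.
have /choice [i Hi] : forall y, exists i, X y -> y <= x i.
  move=> y; have [Xy|nX] := EM (X y); last by exists k0.
  by have [i yx] := below _ (Xe _ Xy); exists i.
case: (regK) => _ [_ reg].
have [k Hk] : exists k, forall j, (exists2 y, X y & j = i y) -> j < k.
  apply: reg => le; apply: sX; apply: (card_le_trans le).
  have /choice [f Hf] : forall j, exists y, (exists2 y, X y & j = i y) ->
      X y /\ j = i y.
    move=> j; have [[y Xy ej]|n] := EM (exists2 y, X y & j = i y); first by exists y.
    by exists e.
  by apply: (card_le_sig (f := f)) => [j /Hf[]|j j' /Hf[_ {2}->] /Hf[_ {2}->] ->].
exists (x k) => // y Xy; apply: (le_lt_trans (Hi _ Xy)).
by apply: xlt; apply: Hk; exists y.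
Qed.

(** If no piece were stationary, a common bound of the [K] many witnessing functions would show that
    [Z] is not stationary either. *)
Lemma stationary_partition (I : Type) (Z : L -> Prop) (c : L -> I) :
  card_le I K -> stationary Z -> exists i, stationary (fun x => Z x /\ c x = i).
Proof.
move=> cI sZ; apply: contrapT => ns.
have /choice [h Hh] : forall i, exists h, forall x, Z x -> c x = i -> ~ closed_under h x.
  move=> i; apply: contrapT => nh; apply: ns; exists i => h.
  apply: contrapT => nx; apply: nh; exists h => x Zx cx cl; apply: nx.
  by exists x.
have /choice [h' Hh'] := fun x => family_bound (fun i => h i x) cI.
have [x Zx cl] := sZ h'; apply: (Hh _ x Zx erefl) => y yx.
exact: lt_trans (cl _ yx).
Qed.

Lemma stationary_gt (Z : L -> Prop) (c : L) :
  (forall x, Z x -> full_cofinality x) ->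
  stationary Z -> stationary (fun x => Z x /\ c < x).
Proof.
move=> cofZ sZ h; have [x Zx cl] := sZ (fun y => Order.max (h y) c).
have [y yx] := full_cofinality_gt0 (cofZ _ Zx).
exists x; last by move=> z /cl; rewrite gt_max => /andP[].
by split=> //; have := cl _ yx; rewrite gt_max => /andP[].
Qed.

Lemma unbounded_fiber (c : L -> K) : exists i, unbounded (fun x => c x = i).
Proof.
apply: contrapT => ni.
have /choice [b Hb] : forall i, exists b, forall x, c x = i -> x <= b.
  move=> i; apply: contrapT => nb; apply: ni; exists i => b.
  apply: contrapT => nx; apply: nb; exists b => x ex.
  by rewrite leNgt; apply/negP => bx; apply: nx; exists x.
have cK : card_le K K by exists id.
have [m Hm] := family_bound b cK.
by have := Hb _ m erefl; rewrite leNgt Hm.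
Qed.

(* Ulam's matrix argument. *)
Lemma ex_stationary_partition :
  exists phi : L -> L, forall c, stationary (fun x => full_cofinality x /\ phi x = c).
Proof.
have /choice [g Hg] := ex_inj_seg.
have cK : card_le K K by exists id.
have /choice [nu Hnu] : forall c, exists i,
    stationary (fun x => (full_cofinality x /\ c < x) /\ g x c = i).
  move=> c; apply: stationary_partition => //.
  apply: stationary_gt => //; exact: stationary_full_cofinality.
(* Unboundedly many [c] share the value [i0]. As [g x] is injective below [x], at most one of them
   satisfies [c < x] and [g x c = i0]; [phi x] is its index. *)
have [i0 ub] := unbounded_fiber nu.
have [j ji] := unbounded_size ub.
have /choice [phi Hphi] : forall x, exists c, forall c',
    sval (j c') < x -> g x (sval (j c')) = i0 -> c = c'.
  move=> x; have [[c [cx gc]]|n] :=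
    EM (exists c, sval (j c) < x /\ g x (sval (j c)) = i0).
    exists c => c' c'x gc'; apply: ji; apply: sval_inj; apply: (Hg x) => //.
    by rewrite gc gc'.
  by exists x => c cx gc; case: n; exists c.
exists phi => c h; have [x [[cofx cx] gx] cl] := Hnu (sval (j c)) h.
exists x => //; split=> //; apply: Hphi => //; rewrite gx; exact: (svalP (j c)).
Qed.

Lemma inj_map_in (T U : Type) (P : T -> bool) (f : T -> U) (s t : seq T) :
  (forall x y, P x -> P y -> f x = f y -> x = y) ->
  all P s -> all P t -> map f s = map f t -> s = t.
Proof.
move=> fi; elim: s t => [|x s IH] [|y t] //= /andP[Px Ps] /andP[Py Pt] [].
by move=> /fi -> // /IH ->.
Qed.

(** A diagonal intersection indexed by finite sequences: at most [K] many pairs [(s, y)] lie at or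
    below [x], so one value [h x] bounds all [hs s y]. *)
Lemma diagonal_closed (hs : seq (L * (K * K)) -> L -> L) : exists h, forall x,
  closed_under h x -> forall s, all (fun t => t.1 < x) s -> closed_under (hs s) x.
Proof.
have [pr pri] := card_prod regK; have [cs csi] := card_seq regK.
have /choice [h Hh] : forall x, exists b, forall s y,
    all (fun t => t.1 <= x) s -> y <= x -> hs s y < b.
  move=> x; have [g gi] := ex_inj_le_seg x.
  pose P (p : seq (L * (K * K)) * L) := all (fun t => t.1 <= x) p.1 /\ p.2 <= x.
  have le : card_le {p | P p} K.
    pose enc (t : L * (K * K)) := pr (g t.1, pr t.2).
    apply: (card_le_sigl (f := fun p => pr (cs (map enc p.1), g p.2))).
    move=> [s y] [s' y'] [/= As yx] [/= As' y'x] /pri [] /csi es /gi ey.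
    congr (_, _); last exact: ey.
    apply: (inj_map_in _ As As' es) => -[a p] [b q] /= ax bx /pri [] /gi -> //.
    by move=> /pri ->.
  have [b Hb] := family_bound (fun p => hs (sval p).1 (sval p).2) le.
  by exists b => s y As yx; apply: (Hb (exist P (s, y) (conj As yx))).
exists h => x cl s As y yx.
pose m := foldr (fun t c => Order.max t.1 c) y s.
have [mx ym sm] : [/\ m < x, y <= m & all (fun t => t.1 <= m) s].
  rewrite {}/m; elim: s As => [|t s IH] //= /andP[tx /IH [mx ym sm]].
  split; [by rewrite gt_max tx|by rewrite le_max ym orbT|].
  rewrite le_max lexx /=; apply: sub_all sm => u um; by rewrite le_max um orbT.
by apply: lt_trans (cl _ mx); apply: Hh.
Qed.

End SuccessorCardinal.

(** * Walks and oscillations *)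

(** This counts the descents from [true] to [false] in [p :: s]. *)
Fixpoint switches (p : bool) (s : seq bool) : nat :=
  if s is c :: s' then ((p && ~~ c) + switches c s')%N else 0%N.

Lemma switches_cat p s t :
  switches p (s ++ t) = (switches p s + switches (last p s) t)%N.
Proof. by elim: s p => [|c s IH] p //=; rewrite IH addnA. Qed.

Lemma switches_nseq_true p n : switches p (nseq n true) = 0%N.
Proof. by elim: n p => //= n IH p; rewrite IH andbF. Qed.

Lemma switches_nseq_false p n : switches p (nseq n.+1 false) = p.
Proof. by elim: n p => [|n IH] p /=; [case: p|move: (IH false) => /= ->; case: p]. Qed.

Lemma last_nseq (T : Type) (p x : T) n : last p (nseq n.+1 x) = x.
Proof. by elim: n p. Qed.

Lemma ex_logn2 k c : exists2 m, (m <= 2 ^ k.+2)%N & logn 2 (c + m) = k.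
Proof.
(* An odd multiple of [2 ^ k], equal to [2 ^ k.+1 * q.+1 + 2 ^ k] for the quotient [q] of [c] by
   [2 ^ k.+1], hence just above [c]. *)
pose N := (2 ^ k * ((c %/ 2 ^ k.+1).+1.*2.+1))%N.
have Nc : (c <= N <= c + 2 ^ k.+2)%N.
  have := divn_eq c (2 ^ k.+1); have := ltn_pmod c (expn_gt0 2 k.+1).
  rewrite /N; set q := (c %/ _)%N; set r := (c %% _)%N.
  rewrite !expnS; set e := (2 ^ k)%N; move=> re ->.
  rewrite -muln2; apply/andP; split; nia.
case/andP: Nc => cN Nc; exists (N - c)%N; first by rewrite leq_subLR.
rewrite subnKC // lognM ?expn_gt0 // pfactorK // lognE /=.
by rewrite dvdn2 /= odd_double addn0.
Qed.

Section Walk.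
Context (d d' : Order.disp_t) (K : orderType d) (L : orderType d').
Hypothesis regK : infinite_regular_cardinal (fun x y : K => x < y).
Hypothesis succL : successor_cardinal K (fun x y : L => x < y).

Variable g : L -> L -> K.
Hypothesis g_inj : forall x y z, y < x -> z < x -> g x y = g x z -> y = z.

Lemma ex_step : exists step : L -> L -> L, forall a b, a < b ->
  a <= step a b < b /\ forall x, a <= x < b -> g b (step a b) <= g b x.
Proof.
suff /choice [st Hst] : forall p : L * L, exists c, p.1 < p.2 ->
    p.1 <= c < p.2 /\ forall x, p.1 <= x < p.2 -> g p.2 c <= g p.2 x.
  by exists (fun a b => st (a, b)) => a b; apply: (Hst (a, b)).
move=> [a b] /=; have [ab|ba] := ltP a b; last by exists a.
have [|k [[c cab <-] le_c]] :=
  wf_ex_least (P := fun k => exists2 c, a <= c < b & g b c = k) (regular_wf regK).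
  by exists (g b a); exists a; rewrite ?lexx.
by exists c => _; split=> // x xab; apply: le_c; exists x.
Qed.

(* [step a b] is [min (C_b \ a)] for the C-sequence in which [C_b] consists of
   the [x < b] with [g b x < g b y] for all [y] in the interval [(x, b)]. *)
Variable step : L -> L -> L.
Hypothesis stepP : forall a b, a < b ->
  a <= step a b < b /\ forall x, a <= x < b -> g b (step a b) <= g b x.

Lemma step_ge a b : a < b -> a <= step a b.
Proof. by move=> /stepP [/andP[]]. Qed.

Lemma step_lt a b : a < b -> step a b < b.
Proof. by move=> /stepP [/andP[]]. Qed.

Lemma step_min a b x : a < b -> a <= x < b -> g b (step a b) <= g b x.
Proof. by move=> /stepP [_]; apply. Qed.

Lemma step_eq a x b : a <= x -> x < b -> x <= step a b -> step a b = step x b.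
Proof.
move=> ax xb xs; have ab := le_lt_trans ax xb.
apply: (g_inj (x := b)); rewrite ?step_lt //; apply/le_anti.
by rewrite !step_min ?step_lt ?step_ge ?xs ?(le_trans ax) ?step_ge.
Qed.

(** The walk from [b] down to [a], listed from [b] on and without its endpoint [a]. *)
Lemma ex_trace : exists trace : L -> L -> seq L,
  forall a b, trace a b = if a < b then b :: trace a (step a b) else [::].
Proof.
suff /choice [tr Htr] : forall a, exists tr : L -> seq L,
    forall b, tr b = if a < b then b :: tr (step a b) else [::] by exists tr.
move=> a; pose F b (rec : forall c, c < b -> seq L) :=
  if pselect (a < b) is left ab then b :: rec _ (step_lt ab) else [::].
exists (Fix (successor_wf succL) (fun=> seq L) F) => b.
rewrite Fix_eq => [|x f h fh].
  by rewrite /F; case: pselect => [ab|/negP/negbTE -> //]; rewrite ab.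
by rewrite /F; case: pselect => // ab; rewrite fh.
Qed.

Variable trace : L -> L -> seq L.
Hypothesis trace_rec :
  forall a b, trace a b = if a < b then b :: trace a (step a b) else [::].

Lemma trace_lt a b : a < b -> trace a b = b :: trace a (step a b).
Proof. by rewrite trace_rec => ->. Qed.

Lemma tracexx a : trace a a = [::].
Proof. by rewrite trace_rec ltxx. Qed.

Lemma mem_trace a b c : c \in trace a b -> a < c.
Proof.
elim: (successor_wf succL b) => {}b _ IH; rewrite trace_rec.
case: ifP => // ab; rewrite inE => /orP[/eqP -> //|]; apply: IH; exact: step_lt.
Qed.

Lemma card_small_weight b k : ~ card_le K {c | c < b /\ g b c <= k}.
Proof.
have [m km] := regular_no_max regK k.
move=> le; apply: (card_seg_small regK (m := m)); apply: (card_le_trans le).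
apply: (card_le_sig (f := g b)) => [c [_ ck]|x y [xb _] [yb _]].
  exact: le_lt_trans km.
exact: g_inj.
Qed.

(** * Maximal weights of walks and their coherence *)

Variable k0 : K.

(** The largest weight of a step on the walk, a version of Todorcevic's function rho_1. The maximum
    starts from [k0]. *)
Definition height a b : K :=
  foldr (fun c v => Order.max (g c (step a c)) v) k0 (trace a b).

Lemma height_rec a b : a < b ->
  height a b = Order.max (g b (step a b)) (height a (step a b)).
Proof. by move=> ab; rewrite /height trace_lt. Qed.

Lemma card_small1 (P : L -> Prop) (c : L) :
  (forall x, P x -> x = c) -> ~ card_le K {x | P x}.
Proof.
move=> Pc; apply: (card_small_subsingleton regK) => x y; apply: sval_inj.
by rewrite (Pc _ (svalP x)) (Pc _ (svalP y)).
Qed.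

Lemma card_small_sub (P Q : L -> Prop) : (forall x, P x -> Q x) ->
  ~ card_le K {x | Q x} -> ~ card_le K {x | P x}.
Proof. by move=> PQ; apply: contra_not => /card_le_trans; apply; apply: card_le_sub. Qed.

(** A first step from [b] is determined by its weight, which is below [m]. So it suffices that for
    each first step [c] the part of [P] using it is small. *)
Lemma card_small_steps b m (P : L -> Prop) :
  (forall a, P a -> a < b /\ g b (step a b) < m) ->
  (forall c, c < b -> ~ card_le K {a | [/\ P a, a <= c & step a b = c]}) ->
  ~ card_le K {a | P a}.
Proof.
move=> Pb small; apply: (card_small_union regK (i := fun a => g b (step a b)) (m := m)).
  by move=> a /Pb [].
move=> j; have [[a [Pa ga]]|n] := EM (exists a, P a /\ g b (step a b) = j); last first.
  by apply: (card_small1 (c := b)) => x H; case: n; exists x.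
have [ab _] := Pb _ Pa.
apply: card_small_sub (small _ (step_lt ab)) => x [Px gx]; have [xb _] := Pb _ Px.
have e : step x b = step a b by apply: (g_inj (x := b)); rewrite ?step_lt // gx.
by split=> //; rewrite -e step_ge.
Qed.

Lemma card_small_height b k : ~ card_le K {a | a < b /\ height a b <= k}.
Proof.
elim: (successor_wf succL b) => {}b _ IH; have [m km] := regular_no_max regK k.
apply: (card_small_steps (b := b) (m := m)) => [a [ab]|c cb].
  rewrite height_rec // ge_max => /andP[gk _]; split=> //; exact: le_lt_trans km.
apply: card_small_sub (card_small_or regK (card_small1 (c := c) (fun x => id)) (IH c cb)).
move=> a [[ab]]; rewrite height_rec // ge_max => /andP[_ hk].
rewrite le_eqVlt => /orP[/eqP|] ac e; [by left|right].
by rewrite -e in ac *.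
Qed.

(** Induction on [b], splitting by the first step [x]. Where [height a x] exceeds [g b x], the first
    step does not change the maximum, and the induction hypothesis compares [x] with [c]. The
    remaining [a] are few by [card_small_height]. *)
Lemma height_coherent b c : c < b ->
  ~ card_le K {a | a < c /\ height a c <> height a b}.
Proof.
elim: (successor_wf succL b) c => {}b _ IH c cb.
(* For [a < c] the point [c] competes in the minimum defining the first step, so this step weighs at
   most [g b c]. *)
have [m cm] := regular_no_max regK (g b c).
apply: (card_small_steps (b := b) (m := m)) => [a [ac _]|x xb].
  have ab := lt_trans ac cb; split=> //; apply: le_lt_trans cm.
  by apply: step_min => //; rewrite (ltW ac).
have s1 := card_small1 (c := x) (fun x => id).
have s2 := @card_small_height x (g b x).
have s3 : ~ card_le K {a | [/\ a < c, a < x & height a c <> height a x]}.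
  have [cx|xc|->] := ltgtP c x.
  - by apply: card_small_sub (IH x xb c cx) => a [].
  - apply: card_small_sub (IH c cb x xc) => a [ac ax ne]; split=> // e.
    by apply: ne; rewrite e.
  - by apply: (card_small1 (c := b)) => a [].
apply: card_small_sub (card_small_or regK s1 (card_small_or regK s2 s3)).
move=> a [[ac ne]]; have ab := lt_trans ac cb.
rewrite le_eqVlt => /orP[/eqP|] ax e; [by left|right].
have [le|lt] := leP (height a x) (g b x); [by left|right].
by split=> // e'; apply: ne; rewrite [RHS]height_rec // e e' max_r // ltW.
Qed.

Lemma height_coherent_tail x a b : full_cofinality K x -> x <= a -> x <= b ->
  exists2 t, t < x & forall y, t <= y -> y < x -> height y a = height y b.
Proof.
move=> cofx.
have tail c : x <= c ->
    exists2 t, t < x & forall y, t <= y -> y < x -> height y c = height y x.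
  rewrite le_eqVlt => /orP[/eqP <-|xc].
    by have [t tx] := full_cofinality_gt0 regK cofx; exists t.
  have [|t tx Ht] := cofx _ _ (height_coherent xc); first by move=> y [].
  exists t => // y ty yx; apply: contrapT => ne.
  have : y < t by apply: Ht; split=> // e; apply: ne.
  by rewrite ltNge ty.
move=> /tail [t tx Ht] /tail [u ux Hu]; exists (Order.max t u); first by rewrite gt_max tx.
by move=> y; rewrite ge_max => /andP[ty uy] yx; rewrite Ht // Hu.
Qed.

(* [low a b] is the least [x] with [C_b] disjoint from the interval [[x, a)]. *)
Lemma ex_low : exists low : L -> L -> L, forall a b,
  [/\ low a b <= a, step (low a b) b = step a b &
      forall x, step x b = step a b -> low a b <= x].
Proof.
suff /choice [lo Hlo] : forall p : L * L, exists c,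
    [/\ c <= p.1, step c p.2 = step p.1 p.2 &
        forall x, step x p.2 = step p.1 p.2 -> c <= x].
  by exists (fun a b => lo (a, b)) => a b; apply: (Hlo (a, b)).
move=> [a b] /=; have [|c [sc le_c]] := wf_ex_least
  (P := fun c => step c b = step a b) (successor_wf succL); first by exists a.
by exists c; split=> //; apply: le_c.
Qed.

Variable low : L -> L -> L.
Hypothesis lowP : forall a b, [/\ low a b <= a, step (low a b) b = step a b &
  forall x, step x b = step a b -> low a b <= x].

Lemma low_between a x b : low a b <= x -> x <= a -> a < b ->
  step x b = step a b /\ low x b = low a b.
Proof.
move=> lx xa ab; have [_ sl le_l] := lowP a b.
have e : step x b = step a b.
  have xb := le_lt_trans xa ab; apply: step_eq => //.
  rewrite -(step_eq lx) ?sl //; first exact: step_ge.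
  by rewrite (le_trans xa) ?step_ge.
split=> //; have [_ sx le_x] := lowP x b.
by apply/le_anti; rewrite le_x ?le_l // ?e // -e.
Qed.

(** The points below [a] weighing at most as much as [step a b] are bounded by some [t < a]. The
    step from [b] towards [t] weighs no more, so it cannot land in [[t, a)] and equals
    [step a b]. *)
Lemma low_lt a b : full_cofinality K a -> a < b -> low a b < a.
Proof.
move=> cofa ab; pose X y := y < a /\ g b y <= g b (step a b).
have [||t ta Ht] := cofa X; first by move=> y [].
  apply: card_small_sub (@card_small_weight b (g b (step a b))) => y [ya le].
  by split=> //; apply: lt_trans ab.
have [_ _ le_l] := lowP a b; apply: (le_lt_trans _ ta); apply: le_l.
have tb := lt_trans ta ab; apply: step_eq => //; first exact: ltW.
rewrite leNgt; apply/negP => sa.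
have : step t b < t.
  apply: Ht; split=> //; apply: step_min => //.
  by rewrite step_lt // (le_trans (ltW ta)) // step_ge.
by rewrite ltNge step_ge.
Qed.

(** The points weighing at most [g x t] are bounded by some [u < x]. If [low a x < t], then
    [step a x] is such a point and lies below [u], which is impossible for [a >= u]. *)
Lemma low_limit x t : full_cofinality K x -> t < x ->
  exists2 u, u < x & forall a, u <= a -> a < x -> t <= low a x.
Proof.
move=> cofx tx; have [|u ux Hu] := cofx _ _ (@card_small_weight x (g x t)).
  by move=> y [].
exists (Order.max t u) => [|a]; first by rewrite gt_max tx.
rewrite ge_max => /andP[ta ua] ax; rewrite leNgt; apply/negP => lt.
have [_ sl _] := lowP a x; have lx := lt_trans lt tx.
have : step a x < u.
  by apply: Hu; rewrite step_lt // -sl step_min // (ltW lt).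
by rewrite ltNge (le_trans ua) // step_ge.
Qed.

Lemma low_bound x b : full_cofinality K x ->
  exists2 t, t < x & all (fun c => low x c <= t) (trace x b).
Proof.
move=> cofx; have : all (fun c => low x c < x) (trace x b).
  by apply/allP => c /mem_trace xc; apply: low_lt.
elim: (trace x b) => [|c s IH] /=.
  by have [t tx] := full_cofinality_gt0 regK cofx; exists t.
move=> /andP[cx /IH [t tx At]]; exists (Order.max (low x c) t); first by rewrite gt_max cx.
by rewrite le_max lexx /=; apply: sub_all At => y yt; rewrite le_max yt orbT.
Qed.

(** The condition [low x c <= a] says that [C_c] misses [[a, x)], so the walk towards [a] takes the
    same steps until it reaches [x]. *)
Lemma trace_cat a x b : a <= x -> x <= b ->
  all (fun c => low x c <= a) (trace x b) ->
  trace a b = trace x b ++ trace a x /\ {in trace x b, low a =1 low x}.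
Proof.
move=> ax; elim: (successor_wf succL b) => {}b _ IH.
rewrite le_eqVlt => /orP[/eqP <- _|xb]; first by rewrite tracexx.
rewrite (trace_lt xb) /= => /andP[la As].
have [es el] := low_between la ax xb.
have [|e1 e2] := IH _ (step_lt xb) _ As; first exact: step_ge.
rewrite trace_lt ?(le_lt_trans ax) // es e1; split=> // c.
by rewrite inE => /orP[/eqP ->|/e2].
Qed.

(** * Lower traces and oscillation numbers *)

Variable z : L.
Hypothesis z_least : forall x, z <= x.

(* Moore's lower trace, as a list that may repeat its entries. *)
Definition lower_trace a b : seq L := scanl Order.max z (map (low a) (trace a b)).

Lemma scan_max_le (s : seq L) m t : m <= t -> all (fun x => x <= t) s ->
  foldl Order.max m s <= t /\ all (fun x => x <= t) (scanl Order.max m s).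
Proof.
elim: s m => [|x s IH] m mt //= /andP[xt st].
by rewrite ge_max mt xt; apply: IH => //; rewrite ge_max mt.
Qed.

Lemma scan_max_ge (s : seq L) m : all (fun x => m <= x) (scanl Order.max m s).
Proof.
elim: s m => [|x s IH] m //=; rewrite le_max lexx /=.
by apply: sub_all (IH _) => y; rewrite ge_max => /andP[].
Qed.

Lemma lower_trace_le x b t : all (fun c => low x c <= t) (trace x b) ->
  all (fun y => y <= t) (lower_trace x b).
Proof. by move=> At; apply: (scan_max_le _ _).2 => //; rewrite all_map. Qed.

(** The point [t] separates the two parts: the running maximum reached at [x] is at most [t], hence
    absorbed by the first entry after [x]. *)
Lemma lower_trace_cat a x b t : a < x -> x <= b ->
  all (fun c => low x c <= t) (trace x b) -> t <= a -> t <= low a x ->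
  lower_trace a b = lower_trace x b ++ lower_trace a x /\
  all (fun y => t <= y) (lower_trace a x).
Proof.
move=> ax xb At ta tl.
have [|e1 e2] := trace_cat (ltW ax) xb.
  by apply: sub_all At => c /le_trans; apply.
have e3 : map (low a) (trace x b) = map (low x) (trace x b) by apply/eq_in_map.
rewrite /lower_trace e1 map_cat e3 scanl_cat (trace_lt ax) /=.
have le_t : foldl Order.max z (map (low x) (trace x b)) <= t.
  by apply: (scan_max_le _ _).1 => //; rewrite all_map.
rewrite (max_r (z_least _)) (max_r (le_trans le_t tl)); split=> //.
by rewrite /= tl; apply: sub_all (scan_max_ge _ _) => y; apply: le_trans.
Qed.

Lemma lower_trace_nil a b : a < b -> lower_trace a b <> [::].
Proof. by move=> ab; rewrite /lower_trace trace_lt. Qed.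

Lemma lower_trace_lt c b : full_cofinality K c -> all (fun y => y < c) (lower_trace c b).
Proof.
move=> cofc; have [t tc At] := low_bound b cofc.
apply: sub_all (lower_trace_le At) => y /= yt; exact: le_lt_trans tc.
Qed.

(** Otherwise there are counterexamples [(s, k, t)] beyond every [x], unboundedly many with the same
    [k]. Take [K] many with successive blocks [s] and some [a] in [X] beyond all of them: each block
    has a point of height at most [k], against [card_small_height]. *)
Lemma height_large (X : L -> Prop) : unbounded X -> exists x0, forall (s : seq L) k t,
  all (fun y => x0 <= y) s ->
  exists a, [/\ X a, t < a & all (fun y => k < height y a) s].
Proof.
move=> uX; apply: contrapT => nx.
have /choice [w Hw] : forall x, exists w : seq L * K * L,
    all (fun y => x <= y) w.1.1 /\
    forall a, X a -> w.2 < a -> ~~ all (fun y => w.1.2 < height y a) w.1.1.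
  move=> x; apply: contrapT => nw; apply: nx; exists x => s k t xs.
  apply: contrapT => na; apply: nw; exists (s, k, t); split=> //= a Xa ta.
  by apply/negP => sa; apply: na; exists a.
have [k uk] := unbounded_fiber regK succL (fun x => (w x).1.2).
have /choice [r Hr] : forall x, exists y, (w y).1.2 = k /\ x < y.
  by move=> x; have [y] := uk x; exists y.
have /choice [h Hh] : forall x, exists b, all (fun y => y < b) (w (r x)).1.1.
  move=> x; elim: (w (r x)).1.1 => [|y s [b Hb]] /=; first by exists x.
  have [c] := successor_no_max regK succL (Order.max y b).
  rewrite gt_max => /andP[yc bc]; exists c; rewrite yc /=.
  by apply: sub_all Hb => y' /lt_trans; apply.
have seg (i : K) : card_le {j : K | j < i} K by apply: (card_le_sigl (f := id)).
have cK : card_le K K by exists id.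
have [x Hx] := ex_increasing regK succL h (regular_wf regK) seg.
have [m Hm] := family_bound regK succL (fun i => Order.max (w (r (x i))).2 (h (x i))) cK.
have [a Xa ma] := uX m.
have /choice [y Hy] : forall i, exists y, y \in (w (r (x i))).1.1 /\ height y a <= k.
  move=> i; have := Hm i; rewrite gt_max => /andP[wm _].
  have [ek _] := Hr (x i).
  have /allPn [y ys] := (Hw (r (x i))).2 a Xa (lt_trans wm ma).
  by rewrite ek -leNgt => yk; exists y.
have xy i : x i < y i.
  have [ys _] := Hy i; have [_ xr] := Hr (x i); apply: (lt_le_trans xr).
  exact: (allP (Hw (r (x i))).1).
have yh i : y i < h (x i) by have [ys _] := Hy i; apply: (allP (Hh _)).
have mono i j : i < j -> y i < y j.
  by move=> /Hx ij; apply: (lt_trans (yh i)); apply: (lt_trans ij).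
apply: (@card_small_height a k).
have Py i : y i < a /\ height (y i) a <= k.
  split; last by case: (Hy i).
  apply: (lt_trans (yh i)); apply: lt_trans ma.
  by have := Hm i; rewrite gt_max => /andP[].
exists (fun i => exist (fun y => y < a /\ height y a <= k) (y i) (Py i)) => i j [] e.
by case: (ltgtP i j) => // /mono; rewrite e ltxx.
Qed.

(** The number of times that, along the lower trace, agreement of the two heights is followed by
    disagreement. *)
Definition osc a b : nat :=
  switches false [seq height x b == height x a | x <- lower_trace a b].

(** The default [z] is the value when the valuation reaches the length of the walk. *)
Definition osc_point a b : L := nth z (trace a b) (logn 2 (osc a b)).

(** * Realizing consecutive oscillation numbers *)

Section Oscillation.
Variables (A T : L -> Prop) (bsel : L -> L) (k : nat).
Hypothesis cofA : forall a, A a -> full_cofinality K a.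
Hypothesis unbA : unbounded A.
Hypothesis cofT : forall x, T x -> full_cofinality K x.
Hypothesis statT : stationary T.
Hypothesis bselP : forall x, T x -> x < bsel x.
Hypothesis size_bsel : forall x, T x -> size (trace x (bsel x)) = k.

(* The last clause makes the walk from [bsel x] to any point of [[c, x)] go through [x]. *)
Definition admissible c a x : Prop :=
  [/\ A a, T x, c <= a, c <= x & all (fun y => low x y < c) (trace x (bsel x))].

(** The heights themselves are recorded, not only their agreement, so that another point with the
    recorded heights can replace [a]. *)
Definition profile c a b : seq (L * (K * K)) :=
  [seq (x, (height x b, height x a)) | x <- lower_trace c b].

Definition realized c (s : seq (L * (K * K))) : Prop :=
  exists a x, admissible c a x /\ profile c a (bsel x) = s.

(** Lowering the base point from [y] to a nearby [c] keeps the pair admissible and appends the lower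
    trace from [y] to [c]. *)
Lemma admissible_below c y a x t : admissible y a x ->
  all (fun w => low y w <= t) (trace y (bsel x)) ->
  t < c -> c < y -> t <= low c y ->
  [/\ admissible c a x,
      lower_trace c (bsel x) = lower_trace y (bsel x) ++ lower_trace c y &
      all (fun w => t <= w) (lower_trace c y)].
Proof.
move=> [Aa Tx ya yx lx] At tc cy tl.
have xb := ltW (bselP Tx); have yb := le_trans yx xb.
have [e1 e2] := lower_trace_cat cy yb At (ltW tc) tl.
split=> //; split=> //; try exact: le_trans (ltW cy) _.
have [|e3 e4] := trace_cat yx xb.
  by apply: sub_all lx => w /ltW.
apply/allP => w wx; rewrite -e4 //; apply: le_lt_trans tc.
by move/allP: At; apply; rewrite e3 mem_cat wx.
Qed.

Lemma realized_lt c s : full_cofinality K c -> realized c s -> all (fun t => t.1 < c) s.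
Proof.
move=> cofc [a [x [_ <-]]]; rewrite all_map.
by apply: sub_all (lower_trace_lt (bsel x) cofc).
Qed.

Definition same_block (q : bool) (s : seq (L * (K * K))) :=
  all (fun t => (t.2.1 == t.2.2) == q) s.

Definition unextendable q s c : Prop :=
  [/\ full_cofinality K c, realized c s &
   ~ exists s', [/\ s' <> [::], same_block q s' & realized c (s ++ s')]].

Lemma stationary_ex_closed (Z : L -> Prop) (c : L) : stationary Z ->
  (forall x, Z x -> full_cofinality K x) ->
  exists x, [/\ Z x, c < x & forall t, t < x -> exists y, [/\ Z y, t < y & y < x]].
Proof.
move=> sZ cofZ.
have /choice [h Hh] : forall t, exists y, Z y /\ t < y.
  by move=> t; have [y [Zy ty] _] := stationary_gt regK t cofZ sZ id; exists y.
have [x [Zx cx] cl] := stationary_gt regK c cofZ sZ h.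
by exists x; split=> // t tx; exists (h t); case: (Hh t) => Zy ty; split=> //; apply: cl.
Qed.

Lemma profile_cat c y a b : lower_trace c b = lower_trace y b ++ lower_trace c y ->
  profile c a b = profile y a b ++
    [seq (x, (height x b, height x a)) | x <- lower_trace c y].
Proof. by rewrite /profile => ->; rewrite map_cat. Qed.

(* Otherwise some unextendable [y] is a limit of unextendable points [c], and the
   walk from [y] to a suitable [c] extends the profile of [y] by a block for [c]. *)
Lemma unextendable_nonstationary q s : ~ stationary (unextendable q s).
Proof.
move=> sN; have cofN x : unextendable q s x -> full_cofinality K x by case.
(* These points can replace [a] without changing the profile [s]. *)
pose X a := A a /\ all (fun t => height t.1 a == t.2.2) s.
have uX : unbounded X.
  move=> b; have [y [[_ [a [x [[Aa _ ya _ _] es]]] _] by_ _]] :=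
    stationary_ex_closed b sN cofN.
  exists a; last exact: lt_le_trans ya.
  by split=> //; rewrite -es all_map; apply/allP => w _ /=.
have [x0 Hx0] := height_large uX.
have [y [[cofy [a [x [adm es]]] _] x0y Hy]] := stationary_ex_closed x0 sN cofN.
have [Aa Tx ya yx _] := adm; have yb := le_trans yx (ltW (bselP Tx)).
have [t1 t1y At1] := low_bound (bsel x) cofy.
have [t2 t2y Ht2] := height_coherent_tail cofy ya yb.
pose t := Order.max t1 (Order.max t2 x0).
have ty : t < y by rewrite !gt_max t1y t2y.
have [u uy Hu] := low_limit cofy ty.
have [|c [[cofc _ nc] mc cy]] := Hy (Order.max t u); first by rewrite gt_max ty.
move: mc; rewrite gt_max => /andP[tc uc].
have [|adm' el el'] := admissible_below adm _ tc cy (Hu _ (ltW uc) cy).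
  by apply: sub_all At1 => w w1; rewrite le_max w1.
have {}el' w : w \in lower_trace c y -> t2 <= w /\ x0 <= w.
  by move/(allP el'); rewrite !ge_max => /and3P[].
apply: nc; case: q sN cofN Hy => _ _ _.
  (* Agreement block: it lies in [[t2, y)], where the heights of [a] and [bsel x] coincide. *)
  exists [seq (w, (height w (bsel x), height w a)) | w <- lower_trace c y].
  split; last by exists a, x; split=> //; rewrite (profile_cat _ el) es.
    by have := lower_trace_nil cy; case: (lower_trace c y).
  rewrite /same_block all_map; apply/allP => w wl /=.
  rewrite Ht2 ?eqxx //; first by case: (el' w wl).
  by apply: lt_trans cy; apply: (allP (lower_trace_lt y cofc)).
(* Disagreement block: [a] is replaced by some [a'] in [X] whose heights on the block exceed the
   maximum [k1] of those of [bsel x]. *)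
pose k1 := foldr (fun w v => Order.max (height w (bsel x)) v) k0 (lower_trace c y).
have Hk1 w : w \in lower_trace c y -> height w (bsel x) <= k1.
  rewrite {}/k1; elim: (lower_trace c y) => [|w' l IH] //=; rewrite inE le_max.
  by move=> /orP[/eqP ->|/IH ->]; rewrite ?lexx ?orbT.
have [|a' [[Aa' Xa'] ca' la']] := Hx0 (lower_trace c y) k1 c.
  by apply/allP => w /el' [].
exists [seq (w, (height w (bsel x), height w a')) | w <- lower_trace c y].
split.
- by have := lower_trace_nil cy; case: (lower_trace c y).
- rewrite /same_block all_map; apply/allP => w wl /=.
  have /lt_eqF -> // : height w (bsel x) < height w a'.
  by apply: (le_lt_trans (Hk1 w wl)); apply: (allP la').
exists a', x; split; first by case: adm' => _ ? _ ? ?; split=> //; apply: ltW.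
rewrite (profile_cat _ el); congr (_ ++ _); rewrite -es; apply/eq_in_map => w wl.
move: Xa'; rewrite -es all_map => /allP /(_ w wl) /eqP /= ->.
by [].
Qed.

Lemma same_block_status q s : same_block q s ->
  [seq t.2.1 == t.2.2 | t <- s] = nseq (size s) q.
Proof. by elim: s => [|t s IH] //= /andP[/eqP -> /IH ->]. Qed.

Let status (s : seq (L * (K * K))) := [seq t.2.1 == t.2.2 | t <- s].

(** A block of agreement followed by a block of disagreement adds exactly one descent and ends in
    [false] again. *)
Lemma realized_extend c : (forall q s, realized c s -> ~ unextendable q s c) ->
  full_cofinality K c -> forall s, realized c s -> last false (status s) = false ->
  exists s', [/\ realized c (s ++ s'), last false (status (s ++ s')) = false &
    switches false (status (s ++ s')) = (switches false (status s)).+1].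
Proof.
move=> Hc cofc s rs ls.
have ext q s1 : realized c s1 ->
    exists s', [/\ s' <> [::], same_block q s' & realized c (s1 ++ s')].
  by move=> rs1; apply: contrapT => n; apply: (Hc q s1 rs1).
have [s1 [n1 /same_block_status b1 r1]] := ext true s rs.
have [s2 [n2 /same_block_status b2 r2]] := ext false (s ++ s1) r1.
exists (s1 ++ s2); rewrite catA; split=> //.
  rewrite /status !map_cat !last_cat b2; case: s2 n2 {b2 r2} => // t s2 _.
  exact: last_nseq.
rewrite /status !map_cat !switches_cat -/status ls b1 b2 switches_nseq_true addn0 last_cat.
case: s1 n1 {b1 r1 r2} => // t1 s1 _; case: s2 n2 {b2} => // t2 s2 _.
by rewrite last_nseq switches_nseq_false addn1.
Qed.

Lemma ex_uniform_bound x (P : nat -> L -> Prop) n : full_cofinality K x ->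
  (forall m t t', t <= t' -> P m t -> P m t') ->
  (forall m, (m <= n)%N -> exists2 t, t < x & P m t) ->
  exists2 t, t < x & forall m, (m <= n)%N -> P m t.
Proof.
move=> cofx mono; elim: n => [|n IH] H.
  by have [t tx Pt] := H 0%N (leqnn _); exists t => // m; rewrite leqn0 => /eqP ->.
have [m mn|t tx Ht] := IH; first by apply: H; rewrite leqW.
have [u ux Hu] := H n.+1 (leqnn _); exists (Order.max t u); first by rewrite gt_max tx.
move=> m; rewrite leq_eqVlt => /orP[/eqP ->|].
  by apply: mono Hu; rewrite le_max lexx orbT.
by rewrite ltnS => /Ht; apply: mono; rewrite le_max lexx.
Qed.

(** One diagonal function combines the witnesses of nonstationarity with a choice [hr] of points
    having prescribed heights. It serves at [c] because profiles realized at [c] list only points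
    below [c]. *)
Lemma ex_extendable_point : exists2 c, T c &
  (forall q s, realized c s -> ~ unextendable q s c) /\
  forall a x t, admissible c a x -> t < c -> exists a', [/\ A a', t < a', a' < c &
    all (fun w => height w a' == height w a) (lower_trace c (bsel x))].
Proof.
have /choice [hq Hq] : forall p : bool * seq (L * (K * K)), exists h,
    forall c, unextendable p.1 p.2 c -> ~ closed_under h c.
  move=> [q s]; apply: contrapT => nh; apply: (@unextendable_nonstationary q s) => h.
  apply: contrapT => nc; apply: nh; exists h => c uc cl; apply: nc.
  by exists c.
have /choice [hr Hr] : forall p : seq (L * (K * K)) * L, exists a', forall a,
    A a -> p.2 < a -> all (fun t => height t.1 a == t.2.2) p.1 ->
    [/\ A a', p.2 < a' & all (fun t => height t.1 a' == t.2.2) p.1].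
  move=> p; have [[a [Aa pa sa]]|n] := EM (exists a,
    [/\ A a, p.2 < a & all (fun t => height t.1 a == t.2.2) p.1]); first by exists a.
  by exists z => a Aa pa sa; case: n; exists a.
have [h Hh] := diagonal_closed regK succL (fun s t =>
  Order.max (hr (s, t)) (Order.max (hq (true, s) t) (hq (false, s) t))).
have [c Tc cl] := statT h; exists c => //; split.
  move=> q s rs uq; apply: (Hq (q, s) c uq) => y yc.
  have := Hh c cl s (realized_lt (cofT Tc) rs) y yc.
  by rewrite !gt_max => /and3P[]; case: (q).
move=> a x t adm tc; pose s := profile c a (bsel x).
have rs : realized c s by exists a, x.
have [Aa _ ca _ _] := adm.
have [|A' ta' sa'] := Hr (s, t) a Aa (lt_le_trans tc ca).
  by rewrite all_map; apply/allP => w _ /=.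
exists (hr (s, t)); split=> //.
  have := Hh c cl s (realized_lt (cofT Tc) rs) t tc.
  by rewrite gt_max => /andP[].
by move: sa'; rewrite /= all_map.
Qed.

Lemma ex_osc_point : exists a x, [/\ A a, T x, a < x & osc_point a (bsel x) = x].
Proof.
have [c Tc [Hext Hrefl]] := ex_extendable_point; have cofc := cofT Tc.
(* A realized profile, here with [x = c], is completed by a block of disagreement. *)
have [s0 rs0 ls0] : exists2 s, realized c s & last false (status s) = false.
  have [a Aa ca] := unbA c.
  have adm : admissible c a c.
    split=> //; first exact: ltW.
    by apply/allP => w /mem_trace cw; apply: low_lt.
  have rs : realized c (profile c a (bsel c)) by exists a, c.
  have [s' [ns bs rs']] : exists s', [/\ s' <> [::], same_block false s' &
      realized c (profile c a (bsel c) ++ s')].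
    by apply: contrapT => n; apply: (Hext false _ rs).
  exists (profile c a (bsel c) ++ s') => //.
  rewrite /status map_cat last_cat (same_block_status bs).
  by case: s' ns {bs rs'} => // t s' _; apply: last_nseq.
have /choice [ext Hx] : forall s, exists s', realized c s ->
    last false (status s) = false ->
    [/\ realized c (s ++ s'), last false (status (s ++ s')) = false &
    switches false (status (s ++ s')) = (switches false (status s)).+1].
  move=> s; have [[rs ls]|n] := EM (realized c s /\ last false (status s) = false).
    by have [s' Hs'] := realized_extend Hext cofc rs ls; exists s'.
  by exists [::] => rs ls; case: n.
pose tau m := iter m (fun s => s ++ ext s) s0.
have Htau m : [/\ realized c (tau m), last false (status (tau m)) = false &
    switches false (status (tau m)) = (switches false (status s0) + m)%N].
  elim: m => [|m [r l e]]; first by rewrite addn0.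
  have [r' l' e'] := Hx _ r l; split=> //.
  by rewrite /tau iterS -/(tau m) e' e addnS.
have pre m n : (m <= n)%N -> exists s', tau n = tau m ++ s'.
  elim: n => [|n IH]; first by rewrite leqn0 => /eqP ->; exists [::]; rewrite cats0.
  rewrite leq_eqVlt => /orP[/eqP ->|]; first by exists [::]; rewrite cats0.
  rewrite ltnS => /IH [s' e]; exists (s' ++ ext (tau n)).
  by rewrite /tau iterS -/(tau n) -/(tau m) catA -e.
(* By [ex_logn2], among [n.+1] consecutive numbers one has valuation [k]. *)
pose n := (2 ^ k.+2)%N.
have /choice [am Ham] : forall m, exists p : L * L,
    admissible c p.1 p.2 /\ profile c p.1 (bsel p.2) = tau m.
  by move=> m; have [[a [x H]] _ _] := Htau m; exists (a, x).
pose bm m := bsel (am m).2.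
have [t tc Ht] : exists2 t, t < c & forall m, (m <= n)%N ->
    all (fun w => low c w <= t) (trace c (bm m)) /\
    forall y, t <= y -> y < c -> height y (bm m) = height y c.
  apply: (ex_uniform_bound (P := fun m t =>
    all (fun w => low c w <= t) (trace c (bm m)) /\
    forall y, t <= y -> y < c -> height y (bm m) = height y c)) => //.
    move=> m t t' tt' [At Bt]; split.
      by apply: sub_all At => w /le_trans; apply.
    by move=> y /(le_trans tt'); apply: Bt.
  move=> m _; have [[_ Tx _ cx _] _] := Ham m.
  have cb : c <= bm m := le_trans cx (ltW (bselP Tx)).
  have [t1 t1c At1] := low_bound (bm m) cofc.
  have [t2 t2c At2] := height_coherent_tail cofc cb (lexx c).
  exists (Order.max t1 t2); first by rewrite gt_max t1c.
  split; first by apply: sub_all At1 => w w1; rewrite le_max w1.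
  by move=> y; rewrite ge_max => /andP[_ y2]; apply: At2.
have [u uc Hu] := low_limit cofc tc.
have [admn en] := Ham n.
(* This [a] below [c] copies the heights of [(am n).1] on the longest profile. The shorter profiles
   are prefixes of it, so [a] suits every [m <= n]. *)
have [|a [Aa]] := Hrefl _ _ (Order.max t u) admn; first by rewrite gt_max tc.
rewrite gt_max => /andP[ta ua] ac eqa.
(* The pattern between [a] and [c] is the same for all [m], since there [bm m] has the heights of
   [c]. Each [tau m] ends in [false], so no descent arises at the junction. *)
pose U := [seq height y c == height y a | y <- lower_trace a c].
have osc_m m : (m <= n)%N -> osc a (bm m) =
    (switches false (status s0) + m + switches false U)%N.
  move=> mn; have [admm em] := Ham m; have [At Bt] := Ht m mn.
  have [_ el el'] := admissible_below admm At ta ac (Hu _ (ltW ua) ac).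
  have [_ lm sm] := Htau m; rewrite /osc el map_cat switches_cat.
  have -> : [seq height x (bm m) == height x a | x <- lower_trace c (bm m)]
      = status (tau m).
    rewrite -em /status /profile -map_comp; apply/eq_in_map => w wl /=.
    have [s' es] := pre m n mn.
    have : all (fun t => height t.1 a == t.2.2) (tau n).
      by rewrite -en all_map.
    rewrite es all_cat -em all_map => /andP[/allP /(_ w wl) /eqP /= -> _].
    by [].
  rewrite lm sm; congr (_ + switches _ _)%N; apply/eq_in_map => w wl.
  rewrite Bt //; first by move/allP: el' => /(_ w wl).
  by apply: lt_trans ac; apply: (allP (lower_trace_lt c (cofA Aa))).
have [m mn em] := ex_logn2 k (switches false (status s0) + switches false U).
have [admm _] := Ham m; have [At _] := Ht m mn.
have [[_ Tx _ _ lx] _ _] := admissible_below admm At ta ac (Hu _ (ltW ua) ac).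
have cx : c <= (am m).2 by case: admm.
have ax := lt_le_trans ac cx.
exists a, (am m).2; split=> //.
have [|e1 _] := trace_cat (ltW ax) (ltW (bselP Tx)).
  by apply: sub_all lx => w /ltW.
(* Exactly [k] points of the walk precede [x], so [x] has index [k]. *)
rewrite /osc_point osc_m // addnAC em e1 nth_cat size_bsel // ltnn subnn.
by rewrite trace_lt.
Qed.

End Oscillation.
End Walk.

(** * Colourings over partitions *)

Lemma ex_rectangular_colouring (d d' : Order.disp_t)
    (K : orderType d) (L : orderType d') :
  infinite_regular_cardinal (fun x y : K => x < y) ->
  successor_cardinal K (fun x y : L => x < y) ->
  exists f : L -> L -> L, forall (c : L) (A B : L -> Prop), unbounded A -> unbounded B ->
    exists a b, [/\ a < b, A a, B b & f a b = c].
Proof.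
move=> regK succL.
have [k0 _] := regular_inhabited regK; have [z zP] := successor_least regK succL.
have /choice [g gP] := ex_inj_seg regK succL.
have [step stepP] := ex_step regK g.
have [trace traceP] := ex_trace succL stepP.
have [low lowP] := ex_low succL step.
have [phi phiP] := ex_stationary_partition regK succL.
(* The oscillation argument needs points of full cofinality, so [a] is replaced by such a point
   above it. *)
have /choice [up upP] : forall a : L, exists x, full_cofinality K x /\ a < x.
  move=> a; have cof := stationary_full_cofinality regK succL.
  by have [x [cofx ax] _] := stationary_gt regK a (fun x => id) cof id; exists x.
exists (fun a b => phi (osc_point g step trace k0 low z (up a) b)) => c A B uA uB.
have /choice [bsel bselP] : forall x, exists b, B b /\ x < b.
  by move=> x; have [b] := uB x; exists b.
have [_ [natK _]] := regK.
(* Walk lengths are natural numbers, so one length [k] occurs stationarily often among the points of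
   colour [c]. *)
have [k sk] := stationary_partition regK succL
  (fun x => size (trace x (bsel x))) natK (phiP c).
have [|||||x [x' [[a Aa ->] [[_ phix] _] ax osc]]] :=
  @ex_osc_point _ _ K L regK succL g gP step stepP trace traceP k0 low lowP z zP
    (fun x => exists2 a, A a & x = up a) _ bsel k _ _ _ sk.
- by move=> x [a _ ->]; case: (upP a).
- move=> b; have [a Aa ba] := uA b; exists (up a); first by exists a.
  by apply: lt_trans ba _; case: (upP a).
- by move=> x [[]].
- by move=> x _; case: (bselP x).
- by move=> x [].
exists a, (bsel x'); have [Bb xb] := bselP x'; have [_ aa] := upP a.
split=> //; last by rewrite osc.
exact: lt_trans aa (lt_trans ax xb).
Qed.

Lemma ex_colouring_over_partitions (d d' : Order.disp_t)
    (K : orderType d) (L : orderType d') :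
  infinite_regular_cardinal (fun x y : K => x < y) ->
  successor_cardinal K (fun x y : L => x < y) ->
  forall (n : L -> nat) (p : forall delta : L, L -> L -> 'I_(n delta)),
  exists f : L -> L -> L, forall (delta : L) (A B : L -> Prop),
    has_size_of A -> has_size_of B -> strong_circ (fun x y : L => x < y) f (p delta) A B.
Proof.
move=> regK succL n p; have [f Hf] := ex_rectangular_colouring regK succL.
have [z _] := successor_least regK succL.
have [code codeI] := card_seq (successor_regular regK succL).
have /choice [dec decP] : forall x, exists s, forall s', code s' = x -> s = s'.
  move=> x; have [[s <-]|n'] := EM (exists s, code s = x).
    by exists s => s' /codeI.
  by exists [::] => s' e; case: n'; exists s'.
(* The colour is read as a list: its head is the index [delta], its tail the finitely many values of
   [zeta]; [z] is a default for lists too short. *)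
exists (fun a b => let s := dec (f a b) in nth z (behead s) (p (head z s) a b)).
move=> delta A B /(size_unbounded regK succL) uA /(size_unbounded regK succL) uB zeta.
have [a [b [ab Aa Bb fab]]] :=
  Hf (code (delta :: [seq zeta i | i <- enum 'I_(n delta)])) A B uA uB.
exists a, b; split=> //; rewrite (decP _ _ (esym fab)) /=.
by rewrite (nth_map (p delta a b)) ?size_enum_ord // nth_ord_enum.
Qed.

(** * The countable case and the theorem *)

Lemma nat_infinite_regular : infinite_regular_cardinal (fun x y : nat => (x < y)%N).
Proof.
have wf : well_founded (fun x y : nat => (x < y)%N).
  by elim/ltn_ind => m IH; constructor=> y; apply: IH.
split; [split; [split; [exact: wf|split; [|split]]|]|split].
- by move=> x y t; lia.
- by move=> x; lia.
- by move=> x y; lia.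
- move=> x [f fi]; have : injective (fun i : 'I_x.+1 => Ordinal (svalP (f i))).
    by move=> i j [] /sval_inj /fi /ord_inj.
  by move=> /leq_card; rewrite !card_ord ltnn.
- by exists id.
move=> S; apply: contra_notP => nb.
have [F HF] : exists F : nat -> {x | S x},
    forall i j, (i < j)%N -> (sval (F i) < sval (F j))%N.
  apply: (wf_rec_rel (Q := fun a b : {x | S x} => (sval a < sval b)%N)) => // q h.
  pose b := \max_(i < q) sval (h (exist _ (val i) (ltn_ord i))).
  apply: contrapT => nv; apply: nb; exists b.+1 => s Ss; rewrite ltnS leqNgt.
  apply/negP => bs; apply: nv; exists (exist _ s Ss) => -[i iq] /=.
  apply: leq_ltn_trans bs; rewrite /b.
  have := leq_bigmax
    (F := fun i : 'I_q => sval (h (exist _ (val i) (ltn_ord i)))) (Ordinal iq).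
  by rewrite /= (Prop_irrelevance (ltn_ord (Ordinal iq)) iq).
exists F => i j eij; case: (ltngtP i j) => // /HF; rewrite eij ltnn //.
Qed.

(* kappa = (K, ltK) infinite regular; kappa^+ = (L, ltL); colours lambda = kappa^+
   (type L); p_delta : [kappa^+]^2 -> n_delta for delta < kappa^+.
   Second conjunct: the "in particular" for omega_1 (kappa = omega = nat). *)
Theorem theorem4p3 :
  (forall (K : Type) (ltK : K -> K -> Prop) (L : Type) (ltL : L -> L -> Prop),
    infinite_regular_cardinal ltK -> successor_cardinal K ltL ->
    forall (n : L -> nat) (p : forall delta : L, L -> L -> 'I_(n delta)),
    exists f : L -> L -> L,
      forall (delta : L) (A B : L -> Prop),
        has_size_of A -> has_size_of B -> strong_circ ltL f (p delta) A B)
  /\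
  (forall (L : Type) (ltL : L -> L -> Prop),
    successor_cardinal nat ltL ->
    forall (n : nat) (p : L -> L -> 'I_n),
      (exists f : L -> L -> L, forall A B : L -> Prop,
          has_size_of A -> has_size_of B -> strong_circ ltL f p A B) /\
      (exists f : L -> L -> L, forall A : L -> Prop,
          has_size_of A -> strong_sq ltL f p A)).
Proof.
pose G (K : Type) (ltK : K -> K -> Prop) (L : Type) (ltL : L -> L -> Prop) :=
  infinite_regular_cardinal ltK -> successor_cardinal K ltL ->
  forall (n : L -> nat) (p : forall delta : L, L -> L -> 'I_(n delta)),
  exists f : L -> L -> L, forall (delta : L) (A B : L -> Prop),
    has_size_of A -> has_size_of B -> strong_circ ltL f (p delta) A B.
have wo : forall K ltK, well_order ltK -> forall L ltL, well_order ltL -> G K ltK L ltL.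
  apply: (well_order_elim
    (G := fun K ltK => forall L ltL, well_order ltL -> G K ltK L ltL)).
  move=> d K; apply: (well_order_elim (G := G K (fun x y => x < y))) => d' L.
  exact: ex_colouring_over_partitions.
have main K ltK L ltL : G K ltK L ltL.
  move=> regK succL; have [[woK _] _] := regK; have [[woL _] _] := succL.
  exact: wo woK L ltL woL regK succL.
split=> // L ltL succL n p.
have [_ [[f0 _] _]] := succL.
have [f Hf] := main _ _ _ _ nat_infinite_regular succL (fun=> n) (fun=> p).
(* The sequence of partitions is constant, so any index in [L] serves. *)
by split; exists f => A *; apply: (Hf (f0 0%N)).
Qed.
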